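(* Let $1<p<\infty$, let $q=p/(p-1)$, and let $\omega=\{\omega_k\}_{k\in\mathbb N}$ be an admissible weight. Let $f$ be a polynomial of degree $d\in\mathbb N$ whose zero set is $Z(f)=\{z_1,\dots,z_m\}\subset\mathbb T$ (with $z_1,\dots,z_m$ distinct), with respective multiplicities $b_1,\dots,b_m$. Let $(p_n)_{n\in\mathbb N}$ be the sequence of optimal polynomial approximants to $1/f$ in $\ell^p_A(\omega)$, and put $$d_{t,n}=\Big(\widehat{1-p_nf}(t)\Big)^{<p-1>}\omega_t .$$ Then, for all $n\in\mathbb N$ and all $0\le t\le n+d$, $$d_{t,n}=\sum_{i=1}^{m}\sum_{j=1}^{b_i}A_{i,j,n}\,t^{j-1}z_i^t,$$ where the complex constants $A_{i,j,n}$ ($1\le i\le m$, $1\le j\le b_i$) are the only solution to the following nonlinear system of $d$ equations: for $l=1,\dots,m$ and $s=1,\dots,b_l-1$, $$1=\sum_{t=0}^{n+d}\left(\sum_{i=1}^{m}\sum_{j=1}^{b_i}A_{i,j,n}t^{j-1}\frac{z_i^t}{\omega_t}\right)^{<q-1>}z_l^t,$$ $$0=\sum_{t=0}^{n+d}\left(\sum_{i=1}^{m}\sum_{j=1}^{b_i}A_{i,j,n}t^{j-1}\frac{z_i^t}{\omega_t}\right)^{<q-1>}t^s z_l^t .$$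
   Context: $\mathbb N$ denotes the non-negative integers, $\mathbb D$ the open unit disc of $\mathbb C$ and $\mathbb T$ the unit circle. In the formulas, $t^{0}=1$ also for $t=0$. Admissible weight: a sequence $\omega=\{\omega_k\}_{k\in\mathbb N}$ of positive real numbers with $\omega_0=1$, $\lim_{k\to\infty}\omega_{k+1}/\omega_k=1$, and such that there is a constant $C>0$ with $C^{-1}\omega_k\le\omega_{k+t}\le C\omega_k$ for all $t,k\in\mathbb N$ with $0\le t\le k+1$. For $1\le p<\infty$, $\ell^p_A(\omega)$ is the space of analytic functions $g(z)=\sum_{k\in\mathbb N}a_kz^k$ on $\mathbb D$ with finite norm $\|g\|_{p,\omega}=\big(\sum_{k=0}^\infty|a_k|^p\omega_k\big)^{1/p}$. $\mathcal P_n$ is the space of polynomials of degree at most $n$. For $f\in\ell^p_A(\omega)$ and $n\in\mathbb N$, $p_n\in\mathcal P_n$ is an optimal polynomial approximant (of order $n$) to $1/f$ in $\ell^p_A(\omega)$ if $\|1-p_nf\|_{p,\omega}=\inf_{P\in\mathcal P_n}\|1-Pf\|_{p,\omega}$. For $1<p<\infty$ and $f\not\equiv0$ it exists and is unique. $\hat g(k)$ denotes the Taylor coefficient of order $k$ of $g$ around $0$. For $z=re^{i\theta}$ with $r>0$ and $s\ge0$, $z^{<s>}:=r^se^{-i\theta}$; and $0^{<s>}:=0$. *)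

(* Defs.v *)
From HB Require Import structures.
From mathcomp Require Export all_boot all_order all_algebra complex.
From mathcomp Require Export all_classical all_reals all_analysis.
Export numFieldNormedType.Exports.

Set Implicit Arguments.
Unset Strict Implicit.
Unset Printing Implicit Defensive.

Import Order.TTheory GRing.Theory Num.Theory.

Local Open Scope classical_set_scope.
Local Open Scope ring_scope.
Local Open Scope complex_scope.

Definition admissible_weight (R : realType) (w : nat -> R) : Prop :=
  [/\ forall k, 0 < w k,
      w 0%N = 1,
      w k.+1 / w k @[k --> \oo] --> (1 : R) &
      exists2 C : R, 0 < C &
        forall t k, (t <= k.+1)%N ->
          C^-1 * w k <= w (k + t)%N /\ w (k + t)%N <= C * w k].

(* An analytic function on the open unit disc is represented by a total
   function K -> K; nothing below depends on its values outside the disc. *)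
Definition taylor_coef (K : numFieldType) (g : K -> K) (k : nat) : K :=
  derive1n k (g : K -> K^o) 0 / k`!%:R.

Definition analytic_on_disc (K : numFieldType) (g : K -> K) : Prop :=
  forall x : K, `|x| < 1 ->
    series (fun k => taylor_coef g k * x ^+ k : K^o) @ \oo --> (g x : K^o).

Definition lpw_norm (R : realType) (p : R) (w : nat -> R) (g : R[i] -> R[i])
    : \bar R :=
  ((\sum_(0 <= k <oo) (Normc.normc (taylor_coef g k) `^ p * w k)%:E)
     `^ (p^-1))%E.

Definition ellpA (R : realType) (p : R) (w : nat -> R) : set (R[i] -> R[i]) :=
  [set g | analytic_on_disc g /\ (lpw_norm p w g < +oo)%E].

(* Polynomials Q with [size Q <= n.+1] are those of degree at
   most n, the zero polynomial included. *)
Definition optimal_approximant (R : realType) (p : R) (w : nat -> R)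
    (f : R[i] -> R[i]) (n : nat) (P : {poly R[i]}) : Prop :=
  [/\ ellpA p w f,
      (size P <= n.+1)%N &
      lpw_norm p w (fun x => 1 - P.[x] * f x) =
      ereal_inf [set lpw_norm p w (fun x => 1 - Q.[x] * f x)
                | Q in [set Q : {poly R[i]} | (size Q <= n.+1)%N]]].

(* For x = r e^(i theta) with r > 0, e^(-i theta) is the conjugate of x
   divided by its modulus. *)
Definition angle_pow (R : realType) (x : R[i]) (s : R) : R[i] :=
  if x == 0 then 0
  else (Normc.normc x `^ s)%:C * (conjc x / (Normc.normc x)%:C).

Definition inner_sum (R : realType) (w : nat -> R) (m : nat)
    (z : 'I_m -> R[i]) (b : 'I_m -> nat) (A : 'I_m -> nat -> R[i]) (t : nat)
    : R[i] :=
  \sum_(i < m) \sum_(1 <= j < (b i).+1)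
    A i j * t%:R ^+ (j - 1) * (z i ^+ t / (w t)%:C).

(* The first equation is required for every l, also when [b l = 1]; the total
   number of equations is the sum of the [b l]. *)
Definition solves_system (R : realType) (q : R) (w : nat -> R) (m : nat)
    (z : 'I_m -> R[i]) (b : 'I_m -> nat) (N : nat)
    (A : 'I_m -> nat -> R[i]) : Prop :=
  forall l : 'I_m,
    1 = \sum_(0 <= t < N.+1)
          angle_pow (inner_sum w z b A t) (q - 1) * z l ^+ t
    /\
    (forall s : nat, (1 <= s)%N -> (s <= b l - 1)%N ->
      0 = \sum_(0 <= t < N.+1)
            angle_pow (inner_sum w z b A t) (q - 1) * t%:R ^+ s * z l ^+ t).

(* Main.v *)
(** Write g = 1 - p_n f and N = n + d.  Young's inequality gives
    |x|^p >= |y|^p + p Re (y^<p-1> (x - y)).  Applied at y = g + e h against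
    x = g and letting e -> 0+, it turns minimality of g into the
    orthogonality relations sum_t d_t h^(t) = 0 for every multiple h of f of
    degree at most N.  For h = X^k f these say that (d_t) satisfies the linear
    recurrence with characteristic polynomial f, whose solutions are the
    exponential polynomials sum A_ij t^(j-1) z_i^t.  Dually, with
    theta = X d/dX, a polynomial h is divisible by f iff
    (theta^s h)(z_i) = sum_t h^(t) t^s z_i^t vanishes for all s < b_i; for
    h = 1 - g this is the nonlinear system, since u |-> u^<q-1> inverts
    u |-> u^<p-1>.  Conversely, a solution of the system yields 1 - Q f whose
    dual sequence is orthogonal to the same multiples of f, and the strict
    monotonicity of u |-> u^<p-1> (up to conjugation) forces 1 - Q f = g. *)

Require Import Defs.
From mathcomp Require Import ring lra zify.

Set Implicit Arguments.
Unset Strict Implicit.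
Unset Printing Implicit Defensive.

Import Order.TTheory GRing.Theory Num.Theory.

Local Open Scope ring_scope.
Local Open Scope complex_scope.

(** * Multiplicities of roots and the operator [X d/dX] *)

Section EulerOperator.
Variable F : numClosedFieldType.
Implicit Types (h f u : {poly F}) (x : F).

Definition euler h : {poly F} := 'X * h^`().

Lemma coef_iter_euler s h t : (iter s euler h)`_t = t%:R ^+ s * h`_t.
Proof.
elim: s t => [|s IHs] t; first by rewrite expr0 mul1r.
rewrite iterS coefXM; case: t => [|t]; first by rewrite exprS !mul0r.
by rewrite coef_deriv IHs exprS -mulrA mulr_natl.
Qed.

Lemma horner_iter_euler s h x n : (size h <= n)%N ->
  (iter s euler h).[x] = \sum_(0 <= t < n) h`_t * t%:R ^+ s * x ^+ t.
Proof.
move=> hn; rewrite big_mkord (@horner_coef_wide _ n).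
  by apply: eq_bigr => i _; rewrite coef_iter_euler [_ * h`_i]mulrC.
apply/leq_sizeP => j nj; rewrite coef_iter_euler nth_default ?mulr0//.
exact: leq_trans nj.
Qed.

Lemma dvdp_euler x b h :
  ('X - x%:P) ^+ b.+1 %| h -> ('X - x%:P) ^+ b %| euler h.
Proof.
case/dvdpP => u ->; rewrite /euler derivM deriv_exp derivXsubC mul1r /=.
apply/dvdp_mull/dvdp_add; first by rewrite exprS mulrA dvdp_mull.
by rewrite dvdp_mull// -mulr_natl dvdp_mull.
Qed.

(** Since [x != 0], the factor ['X] of the operator is coprime to ['X - x], so in characteristic 0
    each application lowers a positive multiplicity at [x] by exactly one, just as a derivative
    does. Unlike derivatives, its iterates act diagonally on coefficients, by [t ^ s]. *)
Lemma dvdp_XsubC_exp_eulerP x b h : x != 0 ->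
  ('X - x%:P) ^+ b %| h <-> (forall s, (s < b)%N -> (iter s euler h).[x] = 0).
Proof.
move=> x0; split.
  move=> + s; elim: s b h => [|s IHs] [|b] h //= hb sb.
    apply/eqP; rewrite -[_ == 0]/(root h x) -dvdp_XsubCl.
    by apply: dvdp_trans hb; rewrite exprS dvdp_mulr.
  by rewrite -iterS iterSr; apply: (IHs b) => //; exact: dvdp_euler.
elim: b h => [|b IHb] h hs; first by rewrite dvd1p.
have /dvdpP[u hu] := IHb h (fun s sb => hs s (ltnW sb)).
have : ('X - x%:P) ^+ b %| euler h.
  by apply: IHb => s sb; rewrite -iterSr; exact: hs.
rewrite /euler Gauss_dvdpr; last first.
  by rewrite coprimepX rootE horner_exp hornerXsubC sub0r expf_eq0 oppr_eq0
    (negPf x0) andbF.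
rewrite hu derivM deriv_exp derivXsubC mul1r.
rewrite (dvdp_addr _ (dvdp_mull _ (dvdpp _))).
(* For exponent 0 divisibility of the derivative carries no information, and the condition at
   [s = 0] is used directly. Otherwise what remains is that a nonzero integer times
   [u * ('X - x) ^ b] is divisible by one more power of ['X - x], hence so is [u] by ['X - x]. *)
case: b hs hu {IHb} => [|b] hs hu /=.
  by move=> _; rewrite mulr1 expr1 dvdp_XsubCl; apply/eqP;
    move: (hs 0%N isT); rewrite /= hu mulr1.
rewrite -mulr_natl mulrCA mulrA [_ ^+ b.+1 in X in X -> _]exprS.
rewrite dvdp_mul2r; last first.
  by rewrite expf_neq0// polyXsubC_eq0.
rewrite mulr_natl -scaler_nat dvdpZr ?pnatr_eq0// => xu.
by rewrite [_ ^+ b.+2]exprS dvdp_mul2r// expf_neq0// polyXsubC_eq0.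
Qed.

(** Both polynomials split, and multiplicities are counts in their lists of roots; comparing counts
    makes the roots of [f] a sublist of those of [h] up to permutation. *)
Lemma dvdp_mupP f h : f != 0 -> h != 0 ->
  (forall x, (mup x f <= mup x h)%N) -> f %| h.
Proof.
move=> f0 h0 fh.
have [r fE] := closed_field_poly_normal f.
have [s hE] := closed_field_poly_normal h.
have mupZ c (t : seq F) x : c != 0 ->
    mup x (c *: \prod_(y <- t) ('X - y%:P)) = count_mem x t.
  move=> c0; rewrite -mul_polyC mupMr ?mu_prod_XsubC//.
  by rewrite rootE hornerC.
have /count_subseqP[t tr pt] : forall x, (count_mem x r <= count_mem x s)%N.
  by move=> x; move: (fh x); rewrite fE hE !mupZ ?lead_coef_eq0.
have /perm_to_subseq/=[t'] := tr.
rewrite fE hE dvdpZl ?lead_coef_eq0// dvdpZr ?lead_coef_eq0//.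
rewrite (perm_big _ pt)/= => pst.
by rewrite [X in _ %| X](perm_big _ pst) big_cat dvdp_mulr.
Qed.

(** Each entry of the list of roots adds one to exactly one count, as [z] is injective. This matches
    the number of unknown constants with the degree of [f]. *)
Lemma size_mup_sum f (m : nat) (z : 'I_m -> F) : f != 0 -> injective z ->
  (forall x, root f x -> exists i, x = z i) ->
  (size f).-1 = (\sum_(i < m) mup (z i) f)%N.
Proof.
move=> f0 zI fz; have [r fE] := closed_field_poly_normal f.
have lf0 : lead_coef f != 0 by rewrite lead_coef_eq0.
have mupE x : mup x f = count_mem x r.
  by rewrite fE -mul_polyC mupMr ?mu_prod_XsubC// rootE hornerC.
have -> : (size f).-1 = size r by rewrite fE size_scale// size_prod_XsubC.
have rz : all (fun x => x \in codom z) r.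
  apply/allP => x xr; have [|i ->] := fz x; last exact: codom_f.
  by rewrite fE rootZ// root_prod_XsubC.
under eq_bigr do rewrite mupE.
elim: r rz {fE mupE} => [_|x r IHr /= /andP[/codomP[j ->] /IHr->]].
  by rewrite big1.
rewrite big_split/= [X in (X + _)%N](bigD1 j)//= eqxx.
rewrite [X in (_ + X + _)%N]big1 ?addn0 ?add1n// => i ij.
by apply/eqP; rewrite eqb0 eq_sym (inj_eq zI).
Qed.

End EulerOperator.

(** * Exponential polynomials, moments and interpolation *)

Section ExponentialPolynomials.
Variables (F : numClosedFieldType) (m : nat) (z : 'I_m -> F) (b : 'I_m -> nat).
Variable (f : {poly F}).
Hypotheses (f0 : f != 0) (z_inj : injective z) (z0 : forall i, z i != 0).
Hypothesis (root_f : forall x : F, root f x -> exists i, x = z i).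
Hypothesis (b_mup : forall i, b i = mup (z i) f).

Definition exp_poly (A : 'I_m -> nat -> F) (t : nat) : F :=
  \sum_(i < m) \sum_(1 <= j < (b i).+1) A i j * t%:R ^+ (j - 1) * z i ^+ t.

Lemma dvdp_momentsP (h : {poly F}) N : (size h <= N)%N ->
  f %| h <-> (forall i s, (s < b i)%N ->
    \sum_(0 <= t < N) h`_t * t%:R ^+ s * z i ^+ t = 0).
Proof.
move=> hN; split=> [fh i s sb|hm].
  rewrite -(horner_iter_euler _ _ hN).
  apply: (dvdp_XsubC_exp_eulerP _ _ (z0 i)).1 sb.
  by apply: dvdp_trans fh; rewrite -mup_geq// b_mup.
have [->|h0] := eqVneq h 0; first exact: dvdp0.
apply: dvdp_mupP => // x.
have [/root_f[i ->]|/mupNroot->//] := boolP (root f x).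
rewrite mup_geq// -b_mup; apply/dvdp_XsubC_exp_eulerP => // s sb.
by rewrite (horner_iter_euler _ _ hN) hm.
Qed.

(** Pairing with an exponential polynomial is a linear combination of the moments that vanish on
    multiples of [f]. *)
Lemma exp_poly_dual A (h : {poly F}) N : (size h <= N)%N -> f %| h ->
  \sum_(0 <= t < N) exp_poly A t * h`_t = 0.
Proof.
move=> hN /(dvdp_momentsP hN) hm.
under eq_bigr do rewrite mulr_suml.
rewrite exchange_big big1// => i _.
under eq_bigr do rewrite mulr_suml.
rewrite exchange_big big_nat big1// => j /andP[j1 jb].
transitivity (A i j * \sum_(0 <= t < N) h`_t * t%:R ^+ (j - 1) * z i ^+ t).
  by rewrite mulr_sumr; apply: eq_bigr => t _; ring.
by rewrite hm ?mulr0// subn1; case: j j1 jb.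
Qed.

Local Notation T := {i : 'I_m & 'I_(b i)}.

Let card_T : #|{: T}| = (size f).-1.
Proof.
rewrite card_tagged sumnE big_map big_enum/= (size_mup_sum f0 z_inj root_f).
by apply: eq_bigr => i _; rewrite card_ord b_mup.
Qed.

(** The confluent Vandermonde matrix at the nodes [z i]. Being square, it samples exactly the
    indices [t] below the degree of [f], by [card_T]. *)
Let M : 'M[F]_#|{: T}| := \matrix_(t, k)
  let u : T := enum_val k in t%:R ^+ tagged u * z (tag u) ^+ t.

(* A row vector in the kernel is a polynomial of size at most d that is
   divisible by f, hence 0. *)
Let M_unit : M \in unitmx.
Proof.
rewrite -row_free_unit; apply/inj_row_free => v vM.
pose h := \poly_(t < #|{: T}|) if insub t is Some k then v 0 k else 0.
have hk k : h`_(val k) = v 0 k.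
  by rewrite coef_poly ltn_ord /= valK.
have hT : (size h <= #|{: T}|)%N by exact: size_poly.
suff h0 : h = 0 by apply/rowP => k; rewrite -hk h0 coef0 mxE.
apply/eqP/negPn/negP => h0.
have : f %| h.
  apply/(dvdp_momentsP hT) => i s sb.
  have /rowP/(_ (enum_rank (Tagged (fun i => 'I_(b i)) (Ordinal sb)))) := vM.
  rewrite !mxE => vM0; rewrite -[RHS]vM0 big_mkord; apply: eq_bigr => k _.
  by rewrite !mxE enum_rankK hk/= mulrA.
by move/(dvdp_leq h0)/leq_trans/(_ hT);
  rewrite card_T -ltnS prednK ?ltnn ?size_poly_gt0.
Qed.

Let coeffs (A : 'I_m -> nat -> F) : 'cV[F]_#|{: T}| :=
  \col_k let u : T := enum_val k in A (tag u) (tagged u).+1.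

Let exp_polyE A (t : 'I_#|{: T}|) : exp_poly A t = (M *m coeffs A) t 0.
Proof.
rewrite !mxE /exp_poly.
transitivity (\sum_(i < m) \sum_(j < b i) A i j.+1 * t%:R ^+ j * z i ^+ t).
  apply: eq_bigr => i _; rewrite big_add1 big_mkord; apply: eq_bigr => j _.
  by rewrite subn1.
rewrite sig_big_dep/= (reindex (@enum_val _ (mem {: T})))/=; last first.
  by apply: onW_bij; exact: enum_val_bij.
by apply: eq_bigr => k _; rewrite !mxE/=; ring.
Qed.

Lemma exp_poly_interp (u : nat -> F) :
  exists A, forall t, (t < (size f).-1)%N -> exp_poly A t = u t.
Proof.
pose x := invmx M *m \col_t u t.
(* Columns count powers from 0 while [A i] is indexed from 1. The values at [j = 0] and [j > b i]
   are arbitrary, as [exp_poly] never reads them. *)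
pose A i j := if insub j.-1 : option 'I_(b i) is Some j'
  then x (enum_rank (Tagged (fun i => 'I_(b i)) j')) 0 else 0.
exists A => t; rewrite -card_T => tT.
rewrite (exp_polyE _ (Ordinal tT)).
have -> : coeffs A = x.
  apply/colP => k; rewrite [LHS]mxE /A /= valK -[in RHS](enum_valK k).
  by case: (enum_val k).
by rewrite mulKVmx// mxE.
Qed.

Lemma exp_poly_inj A B :
  (forall t, (t < (size f).-1)%N -> exp_poly A t = exp_poly B t) ->
  forall i j, (1 <= j)%N -> (j <= b i)%N -> A i j = B i j.
Proof.
move=> AB i [//|j] _ jb.
have : coeffs A = coeffs B.
  rewrite -[LHS](mulKmx M_unit) -[RHS](mulKmx M_unit); congr (_ *m _).
  by apply/colP => t; rewrite -!exp_polyE; apply: AB; rewrite -card_T.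
move/colP/(_ (enum_rank (Tagged (fun i => 'I_(b i)) (Ordinal jb)))).
by rewrite !mxE enum_rankK.
Qed.

End ExponentialPolynomials.

(** * The power [x^<s>]: inversion, convexity, monotonicity, continuity *)

Section AnglePow.
Local Open Scope classical_set_scope.
Variable R : realType.
Implicit Types (x y : R[i]) (s p : R).

Local Notation normc := Normc.normc.
Local Notation Re := complex.Re.
Local Notation Im := complex.Im.

Lemma normc_ge0 x : 0 <= normc x.
Proof. by case: x => a c; rewrite sqrtr_ge0. Qed.

Lemma normc_eq0 x : (normc x == 0) = (x == 0).
Proof. by apply/eqP/eqP => [/Normc.eq0_normc//|->]; rewrite Normc.normc0. Qed.

Lemma normc_conj x : normc (conjc x) = normc x.
Proof. by case: x => a c /=; rewrite sqrrN. Qed.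

Lemma conjcM x y : conjc (x * y) = conjc x * conjc y.
Proof. exact: rmorphM. Qed.

Lemma normc_real (a : R) : 0 <= a -> normc a%:C = a.
Proof. by move=> a0; rewrite /= expr0n addr0 sqrtr_sqr ger0_norm. Qed.

Lemma sqr_normcE x : normc x ^+ 2 = Re x ^+ 2 + Im x ^+ 2.
Proof. by case: x => a c /=; rewrite sqr_sqrtr ?addr_ge0 ?sqr_ge0. Qed.

Lemma Re_le_normc x : Re x <= normc x.
Proof.
case: x => a c /=; apply: le_trans (ler_norm _) _.
by rewrite -sqrtr_sqr ler_sqrt ?addr_ge0 ?sqr_ge0// lerDl sqr_ge0.
Qed.

Lemma Re_realM (a : R) x : Re (a%:C * x) = a * Re x.
Proof. by case: x => u v /=; rewrite mul0r subr0. Qed.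

(** No case distinction remains: at [x = 0] the factor [conjc x] vanishes, whatever value the real
    power takes. *)
Lemma angle_powE x s : angle_pow x s = (normc x `^ (s - 1))%:C * conjc x.
Proof.
rewrite /angle_pow; case: eqVneq => [->|x0]; first by rewrite conjc0 mulr0.
have nx0 : normc x != 0 by rewrite normc_eq0.
rewrite powRB ?nx0 ?implybT// powRr1 ?normc_ge0// rmorphM fmorphV/=.
by rewrite mulrA mulrAC.
Qed.

Lemma normc_angle_pow x s : 0 < s -> normc (angle_pow x s) = normc x `^ s.
Proof.
move=> s0; rewrite angle_powE Normc.normcM normc_conj.
by rewrite normc_real ?powR_ge0// mulrC mulr_powRB1// normc_ge0.
Qed.

Lemma Re_angle_pow_le x y s : 0 < s ->
  Re (angle_pow x s * y) <= normc x `^ s * normc y.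
Proof.
move=> s0; rewrite -normc_angle_pow// -Normc.normcM; exact: Re_le_normc.
Qed.

Lemma Re_conjM x : Re (conjc x * x) = normc x ^+ 2.
Proof. by rewrite sqr_normcE; case: x => u v /=; ring. Qed.

Lemma Re_angle_powM x s : 0 < s ->
  Re (angle_pow x s * x) = normc x `^ (s + 1).
Proof.
move=> s0; rewrite angle_powE -mulrA Re_realM Re_conjM expr2.
rewrite -(mulr_powRB1 (normc_ge0 x) (addr_gt0 s0 ltr01)) addrK.
by rewrite -(mulr_powRB1 (normc_ge0 x) s0); ring.
Qed.

(** The two conjugations cancel and the exponents of the modulus multiply to 1. *)
Lemma angle_powK x p q : 0 < p -> p * q = 1 -> angle_pow (angle_pow x p) q = x.
Proof.
move=> p0 pq.
rewrite angle_powE normc_angle_pow// angle_powE.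
rewrite conjcM conjcK conjc_real.
have [->|x0] := eqVneq x 0; first by rewrite !mulr0.
rewrite mulrA -rmorphM/= -powRrM -powRD ?normc_eq0 ?x0 ?implybT//.
by rewrite mulrBr pq mulr1 addrA subrK subrr powRr0 mul1r.
Qed.

(** Young's inequality for [|x|] and [|y|^(p-1)], with exponents [p] and [p / (p - 1)], after
    bounding the real part of the cross term by the product of the moduli. *)
Lemma normc_powR_convex x y p : 1 < p ->
  normc y `^ p + p * Re (angle_pow y (p - 1) * (x - y)) <= normc x `^ p.
Proof.
move=> p1; have p0 : 0 < p by exact: lt_trans p1.
have p10 : 0 < p - 1 by rewrite subr_gt0.
rewrite mulrBr raddfB/= Re_angle_powM// subrK.
have pp : (p / (p - 1))^-1 = 1 - p^-1.
  by rewrite invf_div mulrBl mulfV ?gt_eqF// mul1r.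
have := conjugate_powR (normc_ge0 x) (powR_ge0 (normc y) (p - 1)) p0
  (divr_gt0 p0 p10).
rewrite pp subrKC -powRrM mulrCA mulfV ?gt_eqF// mulr1 => /(_ erefl).
have := Re_angle_pow_le y x p10; rewrite [_ * normc x]mulrC.
move=> /le_trans h /h {h}; rewrite -(ler_pM2l p0).
have -> : p * (normc x `^ p / p + normc y `^ p * (1 - p^-1)) =
  normc x `^ p + (p - 1) * normc y `^ p by field; rewrite gt_eqF.
lra.
Qed.

(** Bounding the cross terms by moduli leaves [(|x| - |y|) (|x|^s - |y|^s) <= 0], which forces
    [|x| = |y|]. The cross-term bounds are then equalities, so [Re (conjc x * y) = |x| |y|], and
    expanding [|x - y|^2] gives 0. *)
Lemma angle_pow_strict_mono x y s : 0 < s ->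
  Re ((angle_pow x s - angle_pow y s) * (x - y)) <= 0 -> x = y.
Proof.
move=> s0; rewrite mulrBl !mulrBr !raddfB/= !Re_angle_powM//.
have hxy := Re_angle_pow_le x y s0; have hyx := Re_angle_pow_le y x s0.
rewrite -(mulr_powRB1 (normc_ge0 x)) ?addr_gt0// addrK.
rewrite -(mulr_powRB1 (normc_ge0 y)) ?addr_gt0// addrK => h.
have nxy : normc x = normc y.
  have : (normc x - normc y) * (normc x `^ s - normc y `^ s) <= 0 by lra.
  apply: contraTeq => nxy; rewrite -ltNge.
  have [xy|xy|xy] := ltgtP (normc x) (normc y).
  - by rewrite nmulr_lgt0 ?subr_lt0// gt0_ltr_powR ?nnegrE ?normc_ge0.
  - by rewrite mulr_gt0 ?subr_gt0// gt0_ltr_powR ?nnegrE ?normc_ge0.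
  - by rewrite xy eqxx in nxy.
have [x0|x0] := eqVneq x 0.
  by rewrite x0; apply/esym/eqP; rewrite -normc_eq0 -nxy x0 Normc.normc0.
have nx0 : normc x `^ (s - 1) != 0 by rewrite powR_eq0 normc_eq0 (negPf x0).
have {h} : Re (angle_pow x s * y) = normc x `^ s * normc y.
  apply/eqP; rewrite eq_le hxy/=; move: h hyx; rewrite -nxy; lra.
rewrite angle_powE -mulrA Re_realM -(mulr_powRB1 (normc_ge0 x) s0) mulrAC mulrC.
move/(mulIf nx0) => xy.
apply/eqP; rewrite -subr_eq0 -normc_eq0 -sqrf_eq0.
have -> : normc (x - y) ^+ 2 =
    normc x ^+ 2 + normc y ^+ 2 - 2 * Re (conjc x * y).
  by rewrite !sqr_normcE; case: (x) (y) => a c [u v] /=; ring.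
by rewrite xy -nxy; apply/eqP; ring.
Qed.

Lemma Re_angle_pow_cvg x y s : 0 < s ->
  (fun e : R => Re (angle_pow (x + e%:C * y) s * y)) @ 0^'+ -->
  Re (angle_pow x s * y).
Proof.
(* The point [x = 0] is separate because [|.|^(s-1)] can be singular there when [s < 1]; the
   expression is then [e^s |y|^(s+1)]. Elsewhere it is continuous in [e]. *)
move=> s0; have [->|x0] := eqVneq x 0.
  rewrite [angle_pow 0 _]/angle_pow eqxx mul0r.
  have h : (fun e : R => e `^ s * normc y `^ (s + 1)) @ 0^'+ --> (0 : R).
    rewrite -[X in _ --> X](mul0r (normc y `^ (s + 1))).
    by apply: cvgMl; exact: powR_cvg0.
  apply: cvg_trans h; apply: near_eq_cvg; near=> e.
  have e0 : 0 < e by [].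
  rewrite add0r angle_powE Normc.normcM normc_real ?ltW// conjcM conjc_real.
  rewrite -(Re_angle_powM _ s0) angle_powE -!mulrA !Re_realM.
  rewrite powRM ?normc_ge0 ?ltW// -[in LHS](mulr_powRB1 (ltW e0) s0).
  by ring.
(* The squared modulus of [x + e y], positive at [e = 0]. *)
pose n2 (e : R) : R := (Re x + e * Re y) ^+ 2 + (Im x + e * Im y) ^+ 2.
have lin_cont (a c : R) : {for 0, continuous (fun e : R => a + e * c)}.
  apply: (@continuousD _ R^o); first exact: cvg_cst.
  by apply: continuousM; [exact: cvg_id|exact: cvg_cst].
have n2_cont : {for 0, continuous n2}.
  apply: (@continuousD _ R^o).
    exact: (continuousM (lin_cont (Re x) (Re y)) (lin_cont (Re x) (Re y))).
  exact: (continuousM (lin_cont (Im x) (Im y)) (lin_cont (Im x) (Im y))).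
have pow_cont : {for Num.sqrt (n2 0), continuous (fun v : R => v `^ (s - 1))}.
  apply: differentiable_continuous; apply/derivable1_diffP.
  apply: derivable_powR; rewrite in_itv/= andbT /n2 !mul0r !addr0.
  by rewrite sqrtr_gt0 -sqr_normcE exprn_gt0// lt0r normc_ge0 normc_eq0 x0.
have sqrt_cont : {for 0, continuous (Num.sqrt \o n2)}.
  exact: (continuous_comp n2_cont (@sqrt_continuous _ _)).
have := @continuousM _ _ _ _ _ (continuous_comp sqrt_cont pow_cont)
  (lin_cont (Re (conjc x * y)) (normc y ^+ 2)).
set G := (X in {for _, continuous X}) => G_cont.
have GE e : Re (angle_pow (x + e%:C * y) s * y) =
    Num.sqrt (n2 e) `^ (s - 1) * (Re (conjc x * y) + e * normc y ^+ 2).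
  rewrite angle_powE -mulrA Re_realM -Re_conjM /n2; congr (_ `^ _ * _).
    by case: (x) (y) => a c [u v] /=; congr (Num.sqrt _); ring.
  by case: (x) (y) => a c [u v] /=; ring.
have -> : (fun e : R => Re (angle_pow (x + e%:C * y) s * y)) = G.
  by apply/funext => e; rewrite GE.
have -> : Re (angle_pow x s * y) = G 0.
  by rewrite -[RHS](GE 0) mul0r addr0.
exact: cvg_at_right_filter G_cont.
Unshelve. all: by end_near. Qed.

End AnglePow.

(** * Taylor coefficients of polynomial functions *)

Lemma is_derive_horner (K : numFieldType) (P : {poly K}) (x : K) :
  is_derive x (1 : K^o) (horner P : K -> K^o) P^`().[x].
Proof.
elim/poly_ind: P => [|P c IH].
  rewrite (_ : horner 0 = cst 0); last by apply/funext => y; rewrite horner0.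
  by rewrite deriv0 horner0; exact: is_derive_cst.
rewrite (_ : horner _ = (horner P : K -> K^o) * (id : K -> K^o)
    + cst (c : K^o)); last first.
  by apply/funext => y; rewrite hornerMXaddC.
apply: is_derive_eq.
by rewrite addr0 derivMXaddC !hornerE /GRing.scale/= mulr1 [x * _]mulrC.
Qed.

Lemma taylor_coef_horner (K : numFieldType) (P : {poly K}) (k : nat) :
  taylor_coef (horner P) k = P`_k.
Proof.
rewrite /taylor_coef.
have -> : derive1n k (horner P : K -> K^o) = horner P^`(k).
  elim: k => [|k IH]; first by rewrite derivn0.
  rewrite derive1nS IH derivnS; apply/funext => x.
  by rewrite derive1E; apply: derive_val; exact: is_derive_horner.
by rewrite horner_coef0 coef_derivn addn0 ffactnn -[P`_k *+ _]mulr_natr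
  mulfK ?pnatr_eq0 -?lt0n ?fact_gt0.
Qed.

(** * First-order optimality conditions *)

Section FirstOrder.
Local Open Scope classical_set_scope.
Variables (R : realType) (p : R) (w : nat -> R).
Hypotheses (p1 : 1 < p) (w0 : forall k, 0 < w k).
Local Notation normc := Normc.normc.

Lemma lpw_norm_horner (G : {poly R[i]}) N : (size G <= N)%N ->
  lpw_norm p w (horner G) =
  ((\sum_(0 <= t < N) normc G`_t `^ p * w t) `^ p^-1)%:E.
Proof.
move=> GN; rewrite /lpw_norm -poweR_EFin; congr (_ `^ _)%E.
rewrite (nneseries_split _ N); last first.
  by move=> k _; rewrite lee_fin mulr_ge0 ?powR_ge0 ?ltW.
rewrite add0n eseries0 ?adde0; last first.
  move=> i Ni _; rewrite taylor_coef_horner nth_default ?(leq_trans GN)//.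
  by rewrite Normc.normc0 powR0 ?mul0r// gt_eqF ?(lt_trans _ p1).
by rewrite sumEFin; under eq_bigr do rewrite taylor_coef_horner.
Qed.

(** The convexity bound is taken at the displaced point, so only the continuity of [x^<p-1>] along a
    ray is needed, not the differentiability of [|.|^p]. *)
Lemma first_order_ge0 N (g h : nat -> R[i]) :
  (forall e, 0 < e -> \sum_(0 <= t < N) normc (g t) `^ p * w t <=
     \sum_(0 <= t < N) normc (g t + e%:C * h t) `^ p * w t) ->
  0 <= \sum_(0 <= t < N) complex.Re (angle_pow (g t) (p - 1) * h t) * w t.
Proof.
move=> gmin.
have p10 : 0 < p - 1 by rewrite subr_gt0.
have p0 : 0 < p by exact: lt_trans p1.
apply: (@cvgr_to_ge _ _ _ _ (fun e : R => \sum_(0 <= t < N)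
    complex.Re (angle_pow (g t + e%:C * h t) (p - 1) * h t) * w t)
    _ _ (_ : _ @ 0^'+ --> _)).
  elim: N {gmin} => [|N IH].
    rewrite big_geq//; under eq_fun do rewrite big_geq//; exact: cvg_cst.
  rewrite big_nat_recr//=; under eq_fun do rewrite big_nat_recr//=.
  by apply: cvgD => //; apply: cvgMl; exact: Re_angle_pow_cvg.
near=> e; have e0 : 0 < e by [].
have := gmin e e0; rewrite -subr_ge0 -sumrB => H.
rewrite -(pmulr_rge0 _ p0) -(pmulr_rge0 _ e0); apply: le_trans H _.
rewrite !mulr_sumr; apply: ler_sum => t _.
(* Here the increment is [- e h], so the growth of each term is at most [p e] times the real part
   whose limit is sought. *)
have := normc_powR_convex (g t) (g t + e%:C * h t) p1.
rewrite opprD addrA subrr add0r mulrN raddfN/= mulrCA Re_realM.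
by move=> /(ler_wpM2r (ltW (w0 t))); lra.
Unshelve. all: by end_near. Qed.

Lemma optimal_min (f P Q : {poly R[i]}) n N :
  optimal_approximant p w (fun x => f.[x]) n P ->
  (n + size f <= N.+1)%N -> (size Q <= n.+1)%N ->
  \sum_(0 <= t < N.+1) normc (1 - P * f)`_t `^ p * w t <=
  \sum_(0 <= t < N.+1) normc (1 - Q * f)`_t `^ p * w t.
Proof.
move=> [_ sP Pmin] fN sQ.
have horner_res (S : {poly R[i]}) :
    (fun x => 1 - S.[x] * f.[x]) = horner (1 - S * f).
  by apply/funext => x; rewrite !hornerE.
have size_res (S : {poly R[i]}) : (size S <= n.+1)%N ->
    (size (1 - S * f)%R <= N.+1)%N.
  move=> sS; rewrite (leq_trans (size_polyD _ _))// geq_max.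
  rewrite size_poly1 size_polyN/=.
  rewrite (leq_trans (size_polyMleq _ _))// (leq_trans _ fN)//.
  by move: sS; case: (size S) => [|k] sS /=;
    rewrite ?leq_add2r// add0n (leq_trans (leq_pred _))// leq_addl.
have : (lpw_norm p w (fun x => 1 - P.[x] * f.[x])%R <=
        lpw_norm p w (fun x => 1 - Q.[x] * f.[x])%R)%E.
  by rewrite Pmin; apply: ereal_inf_lbound; exists Q.
rewrite !horner_res !(lpw_norm_horner (size_res _ _))// lee_fin.
apply: contraTT; rewrite -!ltNge => lt_sum.
have sum_ge0 (S : {poly R[i]}) :
    0 <= \sum_(0 <= t < N.+1) normc (1 - S * f)`_t `^ p * w t.
  by apply: sumr_ge0 => t _; rewrite mulr_ge0 ?powR_ge0 ?ltW.
by apply: gt0_ltr_powR; rewrite ?nnegrE ?invr_gt0 ?(lt_trans _ p1).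
Qed.

(** The pairing [L] is homogeneous over the complex numbers and has nonnegative real part on every
    admissible direction; multiplying the direction by 1, -1, i and -i makes both parts of [L Q]
    vanish. *)
Lemma optimal_orthogonal (f P Q : {poly R[i]}) n N :
  optimal_approximant p w (fun x => f.[x]) n P ->
  (n + size f <= N.+1)%N -> (size Q <= n.+1)%N ->
  \sum_(0 <= t < N.+1)
    angle_pow (1 - P * f)`_t (p - 1) * (w t)%:C * (Q * f)`_t = 0.
Proof.
move=> Popt fN.
pose L (S : {poly R[i]}) := \sum_(0 <= t < N.+1)
  angle_pow (1 - P * f)`_t (p - 1) * (w t)%:C * (S * f)`_t.
have LZ c (S : {poly R[i]}) : L (c *: S) = c * L S.
  by rewrite mulr_sumr; apply: eq_bigr => t _;
    rewrite -[c *: S * f]scalerAl coefZ mulrCA.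
have ReL_ge0 (S : {poly R[i]}) : (size S <= n.+1)%N -> 0 <= complex.Re (L S).
  move=> sS; have sP : (size P <= n.+1)%N by case: Popt.
  have -> : complex.Re (L S) = \sum_(0 <= t < N.+1)
      complex.Re (angle_pow (1 - P * f)`_t (p - 1) * (S * f)`_t) * w t.
    rewrite /L raddf_sum; apply: eq_bigr => t _.
    by rewrite [RHS]mulrC -Re_realM mulrCA mulrA.
  apply: first_order_ge0 => e e0.
  (* Moving the residual by [e S f] amounts to the competitor [P - e S], still of degree at most
     [n]. *)
  have resE t : (1 - P * f)`_t + e%:C * (S * f)`_t =
      (1 - (P - e%:C *: S) * f)`_t.
    by rewrite mulrBl opprB addrA -[e%:C *: S * f]scalerAl addrAC
      [RHS]coefD coefZ.
  under [leRHS]eq_bigr do rewrite resE.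
  apply: (optimal_min Popt fN).
  rewrite (leq_trans (size_polyD _ _))// geq_max sP size_polyN.
  exact: leq_trans (size_scale_leq _ _) sS.
move=> sQ; rewrite -/(L Q).
have ReZ_ge0 c : 0 <= complex.Re (c * L Q).
  by rewrite -LZ ReL_ge0// (leq_trans (size_scale_leq _ _)).
have := (ReZ_ge0 1, ReZ_ge0 (-1),
  ReZ_ge0 (Complex 0 1), ReZ_ge0 (- Complex 0 1)).
case: (L Q) => a c /= [[[]]].
rewrite !(mul0r,mul1r,mulNr,oppr0,subr0,sub0r,opprK,add0r,addr0) => h1 h2 h3 h4.
by congr Complex; lra.
Qed.

End FirstOrder.

(** * Uniqueness principles and the final argument *)

(** Testing against ['X^(t - d) * f] isolates [u t]: earlier values vanish by induction, later
    coefficients vanish by degree, and the coefficient at [t] is the leading one of [f]. *)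
Lemma recurrence_eq0 (F : fieldType) (f : {poly F}) d n (u : nat -> F) :
  size f = d.+1 ->
  (forall k, (k <= n)%N ->
    \sum_(0 <= t < (n + d).+1) u t * ('X^k * f)`_t = 0) ->
  (forall t, (t < d)%N -> u t = 0) ->
  forall t, (t <= n + d)%N -> u t = 0.
Proof.
move=> hf uf ud t; elim/ltn_ind: t => t IH tN.
have [/ud//|dt] := ltnP t d.
have := uf (t - d)%N; rewrite leq_subLR addnC => /(_ tN).
rewrite big_mkord (bigD1 (Ordinal (tN : (t < _.+1)%N)))//= big1 => [|i it].
  rewrite addr0 coefXnM ltnNge leq_subr/= subKn// => /eqP.
  rewrite mulf_eq0 (_ : f`_d = lead_coef f); last by rewrite /lead_coef hf.
  by rewrite lead_coef_eq0 -size_poly_eq0 hf orbF => /eqP.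
have [lt_it|le_ti] := ltnP i t; first by rewrite IH ?mul0r// -ltnS ltn_ord.
have lt_ti : (t < i)%N.
  by rewrite ltn_neqAle le_ti andbT eq_sym;
    apply: contraNneq it => it; apply/eqP/val_inj.
rewrite coefXnM; case: ifP => _; first by rewrite mulr0.
by rewrite nth_default ?mulr0// hf; lia.
Qed.

(** The value [0 ^+ s] is 1 for [s = 0] and 0 otherwise, so it covers the left-hand sides of both
    kinds of equations of the system. *)
Lemma sum_coef1_moment (F : comNzRingType) N s (x : F) :
  \sum_(0 <= t < N.+1) (1 : {poly F})`_t * t%:R ^+ s * x ^+ t = 0 ^+ s.
Proof.
rewrite big_ltn// big_nat big1 => [|t /andP[t0 _]].
  by rewrite coef1 expr0 mul1r mulr1 addr0.
by rewrite coef1 gtn_eqF ?mul0r.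
Qed.

(** By monotonicity every term has nonnegative real part, so a zero sum makes each of these zero,
    and strictness identifies the entries. *)
Lemma angle_pow_sum_inj (R : realType) (s : R) (w : nat -> R) N
    (g c : nat -> R[i]) : 0 < s -> (forall k, 0 < w k) ->
  \sum_(0 <= t < N) (angle_pow (g t) s - angle_pow (c t) s) * (w t)%:C
    * (g t - c t) = 0 ->
  forall t, (t < N)%N -> g t = c t.
Proof.
move=> s0 w0 /(congr1 (@complex.Re R)).
rewrite raddf_sum big_mkord => /= sum0 t tN.
pose r (i : nat) : R :=
  complex.Re ((angle_pow (g i) s - angle_pow (c i) s) * (g i - c i)).
have r_ge0 i : 0 <= r i.
  rewrite leNgt; apply/negP => ri; have gc := angle_pow_strict_mono s0 (ltW ri).
  by move: ri; rewrite /r gc !subrr mul0r ltxx.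
have termE i : complex.Re ((angle_pow (g i) s - angle_pow (c i) s) * (w i)%:C
    * (g i - c i)) = w i * r i.
  by rewrite -Re_realM; congr complex.Re; ring.
apply: (angle_pow_strict_mono s0); rewrite -/(r t) le_eqVlt; apply/orP; left.
have sum_ge0 (i : 'I_N) : true -> 0 <=
    complex.Re ((angle_pow (g i) s - angle_pow (c i) s) * (w i)%:C
      * (g i - c i)).
  by move=> _; rewrite termE mulr_ge0// ltW.
have := psumr_eq0P sum_ge0 sum0 (i := Ordinal tN) isT.
by rewrite termE => /eqP; rewrite mulf_eq0 gt_eqF.
Qed.

Theorem theorem1p4 (R : realType) (p q : R) (hp : 1 < p) (hq : q = p / (p - 1))
    (w : nat -> R) (hw : admissible_weight w)
    (d : nat) (f : {poly R[i]}) (hf : size f = d.+1)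
    (m : nat) (z : 'I_m -> R[i]) (b : 'I_m -> nat)
    (hz_inj : injective z)
    (hz_root : forall x : R[i], root f x <-> exists i : 'I_m, x = z i)
    (hz_unit : forall i : 'I_m, `|z i| = 1)
    (hb : forall i : 'I_m, b i = mup (z i) f)
    (P : nat -> {poly R[i]})
    (hP : forall n : nat, optimal_approximant p w (fun x => f.[x]) n (P n)) :
  forall n : nat, exists A : 'I_m -> nat -> R[i],
    [/\ forall t : nat, (t <= n + d)%N ->
          angle_pow (taylor_coef (fun x => 1 - (P n).[x] * f.[x]) t) (p - 1)
            * (w t)%:C =
          \sum_(i < m) \sum_(1 <= j < (b i).+1)
            A i j * t%:R ^+ (j - 1) * z i ^+ t,
        solves_system q w z b (n + d) A &
        forall B : 'I_m -> nat -> R[i], solves_system q w z b (n + d) B ->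
          forall (i : 'I_m) (j : nat), (1 <= j)%N -> (j <= b i)%N ->
            B i j = A i j].

Proof.
move=> n; set N := (n + d)%N.
have [w0 _ _ _] := hw.
have p10 : 0 < p - 1 by rewrite subr_gt0.
have q10 : 0 < q - 1.
  by rewrite hq subr_gt0 ltr_pdivlMr// mul1r ltrBlDr ltrDl.
have pq : (p - 1) * (q - 1) = 1 by rewrite hq; field; rewrite gt_eqF.
have f0 : f != 0 by rewrite -size_poly_gt0 hf.
have z0 i : z i != 0 by rewrite -normr_eq0 hz_unit oner_eq0.
have root_f x : root f x -> exists i, x = z i by move=> /hz_root.
have b0 i : (0 < b i)%N.
  by rewrite hb -XsubC_dvd// dvdp_XsubCl; apply/hz_root; exists i.
have dE : (size f).-1 = d by rewrite hf.
have wC t : (w t)%:C != 0 :> R[i].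
  by rewrite -(rmorph0 (real_complex R)) (inj_eq (@complexI R)) gt_eqF.
have inner_sumE A t : inner_sum w z b A t = exp_poly z b A t / (w t)%:C.
  rewrite /inner_sum /exp_poly mulr_suml; apply: eq_bigr => i _.
  by rewrite mulr_suml; apply: eq_bigr => j _; rewrite mulrA.
have sP : (size (P n) <= n.+1)%N by case: (hP n).
have size_mulf (Q : {poly R[i]}) : (size Q <= n.+1)%N ->
    (size (Q * f)%R <= N.+1)%N.
  by have := size_polyMleq Q f; rewrite hf /N; lia.
pose g := 1 - P n * f.
pose D t := angle_pow g`_t (p - 1) * (w t)%:C.
have D_orth (Q : {poly R[i]}) : (size Q <= n.+1)%N ->
    \sum_(0 <= t < N.+1) D t * (Q * f)`_t = 0.
  by apply: (optimal_orthogonal hp w0 (hP n)); rewrite hf addnS.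
(* Interpolation fixes [A] from the first [d] values of [D]; the recurrence, satisfied by both
   sequences, extends the equality up to [N]. *)
have [A Ad] := exp_poly_interp f0 hz_inj z0 root_f hb D.
have AD t : (t <= N)%N -> exp_poly z b A t = D t.
  move=> tN; apply/eqP; rewrite -subr_eq0; apply/eqP.
  apply: (recurrence_eq0 (u := fun t => exp_poly z b A t - D t) hf _ _ tN).
    move=> k kn; under eq_bigr do rewrite mulrBl.
    have sX : (size ('X^k : {poly R[i]}) <= n.+1)%N by rewrite size_polyXn.
    rewrite sumrB D_orth// (exp_poly_dual f0 z0 root_f hb) ?subr0 ?size_mulf//.
    exact: dvdp_mulIr.
  by move=> k kd; rewrite Ad ?dE// subrr.
have inner_A t : (t <= N)%N -> angle_pow (inner_sum w z b A t) (q - 1) = g`_t.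
  by move=> tN; rewrite inner_sumE AD// mulfK// angle_powK.
have g_moment l s : (s < b l)%N ->
    \sum_(0 <= t < N.+1) g`_t * t%:R ^+ s * z l ^+ t = 0 ^+ s.
  move=> sb; under eq_bigr do rewrite coefB !mulrBl.
  rewrite sumrB sum_coef1_moment.
  rewrite ((dvdp_momentsP f0 z0 root_f hb (size_mulf _ sP)).1 _ l s sb).
    by rewrite subr0.
  exact: dvdp_mulIr.
exists A; split.
- move=> t tN; rewrite -[RHS]/(exp_poly z b A t) AD// /D /g.
  rewrite (_ : (fun x => _) = horner (1 - P n * f)) ?taylor_coef_horner//.
  by apply/funext => x; rewrite !hornerE.
- move=> l; split=> [|s s1 sb].
    transitivity ((0 : R[i]) ^+ 0); first by rewrite expr0.
    rewrite -(g_moment l 0%N (b0 l)); apply: eq_big_nat => t /andP[_ tN].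
    by rewrite inner_A// expr0 mulr1.
  transitivity ((0 : R[i]) ^+ s); first by rewrite expr0n gtn_eqF.
  rewrite -(g_moment l s); last by rewrite -(prednK (b0 l)) ltnS -subn1.
  by apply: eq_big_nat => t /andP[_ tN]; rewrite inner_A.
move=> B solB.
(* The coefficients of the residual that [B] would produce. The system for [B] says that [1] minus
   the polynomial with these coefficients has the moments of a multiple [Q * f]. *)
pose c t := angle_pow (inner_sum w z b B t) (q - 1).
have BE t : exp_poly z b B t = angle_pow (c t) (p - 1) * (w t)%:C.
  by rewrite /c angle_powK 1?mulrC// inner_sumE mulrC mulfVK.
pose h : {poly R[i]} := 1 - \poly_(t < N.+1) c t.
have sh : (size h <= N.+1)%N.
  by rewrite (leq_trans (size_polyD _ _))// geq_max size_poly1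
    size_polyN size_poly.
have : f %| h.
  apply/(dvdp_momentsP f0 z0 root_f hb sh) => i s sb.
  under eq_bigr do rewrite coefB !mulrBl.
  rewrite sumrB sum_coef1_moment; apply/eqP; rewrite subr_eq0; apply/eqP.
  have [solB0 solBs] := solB i.
  case: s sb => [|s] sb.
    rewrite expr0 [LHS]solB0; apply: eq_big_nat => t /andP[_ tN].
    by rewrite coef_poly tN expr0 mulr1.
  rewrite expr0n/= [LHS](solBs s.+1)//; last by rewrite -ltnS subn1 prednK.
  by apply: eq_big_nat => t /andP[_ tN]; rewrite coef_poly tN.
case/dvdpP => Q hQ.
have sQ : (size Q <= n.+1)%N.
  have [->|Q0] := eqVneq Q 0; first by rewrite size_poly0.
  by move: sh; rewrite hQ size_mul// hf addnS/= /N -addSn leq_add2r.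
have gh t : (t < N.+1)%N -> g`_t - c t = ((Q - P n) * f)`_t.
  move=> tN; rewrite mulrBl -hQ /h /g !coefB coef_poly tN; ring.
have sS : (size (Q - P n)%R <= n.+1)%N.
  by rewrite (leq_trans (size_polyD _ _))// geq_max sQ size_polyN.
(* The difference [g - c] is a multiple of [f] of admissible degree. It is orthogonal to [D] by
   optimality and to the exponential polynomial of [B] by duality, which makes the monotone sum
   zero. *)
have gc : forall t, (t < N.+1)%N -> g`_t = c t.
  apply: (angle_pow_sum_inj p10 w0).
  transitivity (\sum_(0 <= t < N.+1)
      (D t - exp_poly z b B t) * ((Q - P n) * f)`_t).
    by apply: eq_big_nat => t /andP[_ tN]; rewrite -gh// BE /D mulrBl.
  under eq_bigr do rewrite mulrBl.
  rewrite sumrB D_orth// (exp_poly_dual f0 z0 root_f hb) ?subr0 ?size_mulf//.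
  exact: dvdp_mulIr.
apply: (exp_poly_inj f0 hz_inj z0 root_f hb) => t; rewrite dE => td.
have tN : (t <= N)%N by rewrite /N; lia.
by rewrite BE AD// /D gc.
Qed.
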